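(* Let $A$ be a finite-dimensional unimodular ribbon Hopf algebra over a field $k$. If $J(1)=\gamma\Lambda$, where $\gamma\in k$ is a unit, then $\gamma^{-1}J:Z(A)\to Z_\star(A)$ is an algebra isomorphism. In particular, the algebra $Z_\star(A)$ is commutative.
   Context: $A=(A,m,\Delta,S,\epsilon,e)$ is a finite-dimensional Hopf algebra over a field $k$; Sweedler notation $\Delta(a)=\sum a_{(1)}\otimes a_{(2)}$. It is quasitriangular with $R$-matrix $R=\sum_i\alpha_i\otimes\beta_i$ (invertible, $T\Delta(a)=R\Delta(a)R^{-1}$ with $T$ the flip, $(\Delta\otimes1)R=R^{13}R^{23}$, $(1\otimes\Delta)R=R^{13}R^{12}$). Ribbon: $A$ is endowed with an invertible group-like element $g$ ($\Delta(g)=g\otimes g$) such that $S^2(a)=gag^{-1}$ for all $a$, and, with $u=\sum_i S(\beta_i)\alpha_i$, the central ribbon element $\theta=gu^{-1}=u^{-1}g$ satisfies $S(\theta)=\theta$. Unimodular: left and right integrals of $A$ coincide. $\Lambda\in A$ is an integral ($a\Lambda=\Lambda a=\epsilon(a)\Lambda$) and $\lambda\in A^*$ is a right integral for $A^*$ ($\sum\lambda(a_{(1)})a_{(2)}=\lambda(a)1$), with $\lambda(\Lambda)=1$. $Z(A)$ is the center with its usual product; $Z_\star(A)$ is the vector space $Z(A)$ with the product $a\star b=\sum_b\lambda(S(a)b_{(1)})b_{(2)}$ (associative, with unit $\Lambda$). $J:Z(A)\to Z(A)$ is $J(z)=\sum_{i,j}\lambda(z\beta_i\alpha_j)\alpha_i\beta_j$.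 *)

(* Defs.v *)
From HB Require Import structures.
From mathcomp Require Import all_boot all_order all_algebra all_field.

Set Implicit Arguments.
Unset Strict Implicit.
Unset Printing Implicit Defensive.

Import GRing.Theory.

Local Open Scope ring_scope.

(** * Tensor product of finite-dimensional vector spaces

  [tensor U V] is the space of coordinate matrices in the basis
  [e_i ⊗ f_j], where [e = vbasis fullv] and [f = vbasis fullv] are the
  library's bases of [U] and [V].
  [tlift f t] is the value at [t] of the linear map induced by the bilinear
  map [f]: if [t] is a sum of pure tensors [u_i ⊗ v_i] then [tlift f t] is
  the sum of the [f u_i v_i].  It thus renders Sweedler sums:
  [tlift (fun a1 a2 => E) (comul H a)] is the sum of [E] over
  [a1 ⊗ a2 = Delta(a)].  The lemmas below are the universal property. *)

Section Tensor.
Variable k : fieldType.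

Definition tensor (U V : vectType k) : vectType k :=
  'M[k]_(\dim {:U}, \dim {:V}).

Definition tpure (U V : vectType k) (u : U) (v : V) : tensor U V :=
  \matrix_(i, j) (coord (vbasis {:U}) i u * coord (vbasis {:V}) j v).

Definition tlift (U V W : vectType k) (f : U -> V -> W) (t : tensor U V) : W :=
  \sum_i \sum_j
    (t : 'M[k]_(_, _)) i j *: f (vbasis {:U})`_i (vbasis {:V})`_j.

Lemma tpure_linearl (U V : vectType k) (v : V) :
  linear (fun u : U => tpure u v).
Proof.
move=> a u u'; apply/matrixP=> i j.
by rewrite !mxE linearP mulrDl mulrA.
Qed.

Lemma tpure_linearr (U V : vectType k) (u : U) : linear (@tpure U V u).
Proof.
move=> a v v'; apply/matrixP=> i j.
by rewrite !mxE linearP mulrDr mulrCA.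
Qed.

Lemma tlift_linear (U V W : vectType k) (f : U -> V -> W) : linear (tlift f).
Proof.
move=> a s t; rewrite /tlift scaler_sumr -big_split; apply: eq_bigr => i _.
rewrite scaler_sumr -big_split; apply: eq_bigr => j _ /=.
by rewrite !mxE scalerDl scalerA.
Qed.

Lemma tlift_pure (U V W : vectType k) (f : U -> V -> W) u v :
    (forall x, linear (f x)) -> (forall y, linear (f^~ y)) ->
  tlift f (tpure u v) = f u v.
Proof.
move=> fr fl; rewrite /tlift.
have sumr x (c : 'I_(\dim {:V}) -> k) :
    f x (\sum_j c j *: (vbasis {:V})`_j)
      = \sum_j c j *: f x (vbasis {:V})`_j.
  pose m := GRing.isLinear.Build k V W *:%R (f x) (fr x).
  pose F : {linear V -> W} := HB.pack (f x) m.
  rewrite -[f x _]/(F _) linear_sum; apply: eq_bigr => j _.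
  by rewrite linearZ.
have suml y (c : 'I_(\dim {:U}) -> k) :
    f (\sum_i c i *: (vbasis {:U})`_i) y
      = \sum_i c i *: f (vbasis {:U})`_i y.
  pose m := GRing.isLinear.Build k U W *:%R (f^~ y) (fl y).
  pose F : {linear U -> W} := HB.pack (f^~ y) m.
  rewrite -[f _ y]/(F _) linear_sum; apply: eq_bigr => j _.
  by rewrite linearZ.
rewrite [in RHS](coord_vbasis (memvf u)) suml; apply: eq_bigr => i _.
rewrite [in RHS](coord_vbasis (memvf v)) sumr scaler_sumr.
by apply: eq_bigr => j _; rewrite mxE scalerA.
Qed.

Lemma tlift_unique (U V W : vectType k) (h : {linear tensor U V -> W}) t :
  h t = tlift (fun u v => h (tpure u v)) t.
Proof.
rewrite /tlift {1}[t]matrix_sum_delta linear_sum; apply: eq_bigr => i _.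
rewrite linear_sum; apply: eq_bigr => j _; rewrite linearZ; congr (_ *: h _).
apply/matrixP=> i' j'; rewrite !mxE !coord_free ?(basis_free (vbasisP _)) //.
by rewrite -natrM mulnb [i == _]eq_sym [j == _]eq_sym.
Qed.

Definition tmap (U V U' V' : vectType k) (f : U -> U') (g : V -> V') :
    tensor U V -> tensor U' V' :=
  tlift (fun u v => tpure (f u) (g v)).

Definition tswap (U V : vectType k) : tensor U V -> tensor V U :=
  tlift (fun u v => tpure v u).

Definition tassoc (U V W : vectType k) :
    tensor U (tensor V W) -> tensor (tensor U V) W :=
  tlift (fun u => tlift (fun v w => tpure (tpure u v) w)).

(* the product (u ⊗ v)(u' ⊗ v') = uu' ⊗ vv' *)
Definition tmul (U V : vectType k) (mU : U -> U -> U) (mV : V -> V -> V)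
    (s t : tensor U V) : tensor U V :=
  tlift (fun u v => tlift (fun u' v' => tpure (mU u u') (mV v v')) t) s.

End Tensor.

Notation "U \ox V" := (tensor U V) (at level 40, left associativity) : type_scope.
Notation "u \ot v" := (tpure u v) (at level 40, left associativity) : ring_scope.

Section TensorAlgebra.
Variables (k : fieldType) (A : falgType k).

Definition mul2 : (A \ox A) -> (A \ox A) -> (A \ox A) := tmul *%R *%R.

Definition mul3 : (A \ox A \ox A) -> (A \ox A \ox A) -> (A \ox A \ox A) :=
  tmul mul2 *%R.

Definition leg12 (R : A \ox A) : A \ox A \ox A := R \ot 1.

Definition leg13 : A \ox A -> A \ox A \ox A :=
  tlift (fun a b => a \ot 1 \ot b).

Definition leg23 : A \ox A -> A \ox A \ox A :=
  tlift (fun a b => 1 \ot a \ot b).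

End TensorAlgebra.

(** * Hopf algebras *)

Record hopf (k : fieldType) (A : falgType k) := Hopf {
  comul : {linear A -> A \ox A};
  counit : {scalar A};
  antipode : {linear A -> A};
  comulA : forall a,
    tmap comul idfun (comul a) = tassoc (tmap idfun comul (comul a));
  counitl : forall a, tlift (fun a1 a2 => counit a1 *: a2) (comul a) = a;
  counitr : forall a, tlift (fun a1 a2 => counit a2 *: a1) (comul a) = a;
  comul1 : comul 1 = 1 \ot 1;
  comulM : forall a b, comul (a * b) = mul2 (comul a) (comul b);
  counit1 : counit 1 = 1;
  counitM : forall a b, counit (a * b) = counit a * counit b;
  antipodel : forall a,
    tlift (fun a1 a2 => antipode a1 * a2) (comul a) = counit a *: 1;
  antipoder : forall a,
    tlift (fun a1 a2 => a1 * antipode a2) (comul a) = counit a *: 1 }.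

Section HopfTheory.
Variables (k : fieldType) (A : falgType k) (H : hopf A).

Local Notation Delta := (comul H).
Local Notation eps := (counit H).
Local Notation S := (antipode H).

Definition left_integral (x : A) := forall a, a * x = eps a *: x.
Definition right_integral (x : A) := forall a, x * a = eps a *: x.
Definition integral (x : A) := left_integral x /\ right_integral x.

Definition unimodular := forall x, left_integral x <-> right_integral x.

Definition right_cointegral (lam : {scalar A}) :=
  forall a, tlift (fun a1 a2 => lam a1 *: a2) (Delta a) = lam a *: 1.

Record quasitriangular (R : A \ox A) : Prop := Quasitriangular {
  Rmatrix_conj : exists Ri : A \ox A,
    [/\ mul2 R Ri = 1 \ot 1, mul2 Ri R = 1 \ot 1
      & forall a, tswap (Delta a) = mul2 (mul2 R (Delta a)) Ri];
  Rmatrix_comull :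
    tmap Delta idfun R = mul3 (leg13 R) (leg23 R);
  Rmatrix_comulr :
    tassoc (tmap idfun Delta R) = mul3 (leg13 R) (leg12 R) }.

Definition drinfeld (R : A \ox A) : A := tlift (fun a b => S b * a) R.

(* [^-1] is the inverse here since the Drinfeld element is always a unit *)
Definition ribbon_element (R : A \ox A) (g : A) : A := g * (drinfeld R)^-1.

Record ribbon (R : A \ox A) (g : A) : Prop := Ribbon {
  ribbon_quasitriangular : quasitriangular R;
  ribbon_unit : g \is a GRing.unit;
  ribbon_grouplike : Delta g = g \ot g;
  ribbon_antipode2 : forall a, S (S a) = g * a * g^-1;
  ribbon_antipode_theta : S (ribbon_element R g) = ribbon_element R g }.

Definition star (lam : {scalar A}) (a b : A) : A :=
  tlift (fun b1 b2 => lam (S a * b1) *: b2) (Delta b).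

Definition Jmap (R : A \ox A) (lam : {scalar A}) (z : A) : A :=
  tlift (fun ai bi =>
    tlift (fun aj bj => lam (z * bi * aj) *: (ai * bj)) R) R.

End HopfTheory.

(** * Algebra structures carried by a subspace *)

Section SubspaceAlgebra.
Variables (k : fieldType) (A : vectType k).

Record algebra_on (V : {vspace A}) (mul : A -> A -> A) (one : A) : Prop :=
  AlgebraOn {
    algebra_on_mul : {in V &, forall x y, mul x y \in V};
    algebra_on_one : one \in V;
    algebra_on_linearl : forall a, {in V & &, forall x x' y,
      mul (a *: x + x') y = a *: mul x y + mul x' y};
    algebra_on_linearr : forall a, {in V & &, forall x y y',
      mul x (a *: y + y') = a *: mul x y + mul x y'};
    algebra_on_mulA : {in V & &, associative mul};
    algebra_on_mul1l : {in V, left_id one mul};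
    algebra_on_mul1r : {in V, right_id one mul} }.

Record algebra_iso (V : {vspace A}) (mulV : A -> A -> A) (oneV : A)
    (W : {vspace A}) (mulW : A -> A -> A) (oneW : A) (f : A -> A) : Prop :=
  AlgebraIso {
    algebra_iso_dom : algebra_on V mulV oneV;
    algebra_iso_cod : algebra_on W mulW oneW;
    algebra_iso_in : {in V, forall x, f x \in W};
    algebra_iso_linear : forall a, {in V &, forall x y,
      f (a *: x + y) = a *: f x + f y};
    algebra_iso_mul : {in V &, {morph f : x y / mulV x y >-> mulW x y}};
    algebra_iso_one : f oneV = oneW;
    algebra_iso_inj : {in V &, injective f};
    algebra_iso_surj : {in W, forall y, exists2 x, x \in V & f x = y} }.

End SubspaceAlgebra.

(* Main.v *)
Require Import Defs.
From HB Require Import structures.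
From mathcomp Require Import all_boot all_order all_algebra all_field.
Import GRing.Theory.
Local Open Scope ring_scope.

Set Implicit Arguments.
Unset Strict Implicit.
Unset Printing Implicit Defensive.

(* With Q = R_21 R and J(z) = (lam(z .) (x) id)(Q), expanding Delta(J(b)) by the
   hexagon axioms exhibits a copy of Q in the middle, and moving the outer
   factors around with the trace-like property lam(y x) = lam(S^2(x) y) gives,
   for central a and b,
     a * J(b) = J(b J(S(a))),   where * is the product of Z_*.
   For b = 1 this reads J(J(S(a))) = gamma a, since Lambda is the unit of *. So
   J is bijective on the center with inverse gamma^-1 J S, and substituting J(a)
   for a yields J(a) * J(b) = gamma J(a b).  All the structure of Z_*, including
   its associativity and commutativity, is then transported along J. *)

(** * Sweedler calculus *)

Section Linearity.
Variables (k : fieldType).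

Lemma linear_id (U : vectType k) : linear (fun x : U => x).
Proof. by []. Qed.

Lemma linear_comp (U V W : vectType k) (h : {linear V -> W}) (e : U -> V) :
  linear e -> linear (fun x => h (e x)).
Proof. by move=> le a x y; rewrite le linearP. Qed.

Lemma linear_comp_fun (U V W : vectType k) (h : V -> W) (e : U -> V) :
  linear h -> linear e -> linear (fun x => h (e x)).
Proof. by move=> lh le a x y; rewrite le lh. Qed.

Lemma linear_form_scale (U V W : vectType k) (phi : {scalar V}) (e : U -> V)
    (w : W) :
  linear e -> linear (fun x => phi (e x) *: w).
Proof. by move=> le a x y; rewrite le linearP scalerDl scalerA. Qed.

Lemma linear_scale (U W : vectType k) (c : k) (e : U -> W) :
  linear e -> linear (fun x => c *: e x).
Proof. by move=> le a x y; rewrite le scalerDr !scalerA mulrC. Qed.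

Lemma linear_mull (U : vectType k) (A : falgType k) (b : A) (e : U -> A) :
  linear e -> linear (fun x => b * e x).
Proof. by move=> le a x y; rewrite le mulrDr scalerAr. Qed.

Lemma linear_mulr (U : vectType k) (A : falgType k) (b : A) (e : U -> A) :
  linear e -> linear (fun x => e x * b).
Proof. by move=> le a x y; rewrite le mulrDl scalerAl. Qed.

Lemma linear_tpurel (U V W : vectType k) (w : W) (e : U -> V) :
  linear e -> linear (fun x => e x \ot w).
Proof. by move=> le a x y; rewrite le tpure_linearl. Qed.

Lemma linear_tpurer (U V W : vectType k) (w : W) (e : U -> V) :
  linear e -> linear (fun x => w \ot e x).
Proof. by move=> le a x y; rewrite le tpure_linearr. Qed.

Lemma linear_tlift_arg (U V W X : vectType k) (f : U -> V -> W)
    (e : X -> tensor U V) :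
  linear e -> linear (fun x => tlift f (e x)).
Proof. by move=> le a x y; rewrite le tlift_linear. Qed.

Lemma linear_tlift_fun (U V W X : vectType k) (f : X -> U -> V -> W)
    (t : tensor U V) :
  (forall u v, linear (fun x => f x u v)) -> linear (fun x => tlift (f x) t).
Proof.
move=> lf a x y; rewrite /tlift scaler_sumr -big_split; apply: eq_bigr => i _.
rewrite scaler_sumr -big_split; apply: eq_bigr => j _.
by rewrite lf scalerDr !scalerA mulrC.
Qed.

End Linearity.

(** Syntax-directed proof of linearity. [first] picks the factor or argument that carries the
    variable; the last case falls back on linearity hypotheses about an abstract [f], with one or
    two parameters. *)
Ltac lin :=
  cbv beta;
  lazymatch goal with
  | |- forall _, _ => intro; lin
  | |- GRing.linear_for _ (tlift _) => exact: tlift_linear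
  | |- GRing.linear_for _ (GRing.Linear.sort _) => exact: linearP
  | |- GRing.linear_for _ (fun x => x) => exact: linear_id
  | |- GRing.linear_for _ (fun x => _ *: _) =>
    first [apply: linear_scale | apply: linear_form_scale]; lin
  | |- GRing.linear_for _ (fun x => GRing.Linear.sort _ _) =>
    apply: linear_comp; lin
  | |- GRing.linear_for _ (fun x => _ * _) =>
    first [apply: linear_mull | apply: linear_mulr]; lin
  | |- GRing.linear_for _ (fun x => tlift _ _) =>
    first [apply: linear_tlift_fun | apply: linear_tlift_arg]; lin
  | |- GRing.linear_for _ (fun x => _ \ot _) =>
    first [apply: linear_tpurel | apply: linear_tpurer]; lin
  | |- GRing.linear_for _ (GRing.mul _) =>
    exact: (linear_mull _ (@linear_id _ _))
  | |- GRing.linear_for _ (tpure _) => exact: tpure_linearr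
  | |- GRing.linear_for _ _ =>
    first [ by []
          | match goal with
            | lf : forall _, GRing.linear_for _ _ |- _ =>
              apply: (linear_comp_fun (lf _)); solve [lin]
            | lf : forall _ _, GRing.linear_for _ _ |- _ =>
              apply: (linear_comp_fun (lf _ _)); solve [lin]
            end ]
  end.

Section Sweedler.
Variables (k : fieldType).

Lemma eq_tlift (U V W : vectType k) (f f' : U -> V -> W) t :
  (forall u v, f u v = f' u v) -> tlift f t = tlift f' t.
Proof. by move=> ff'; do 2!apply: eq_bigr => ? _; rewrite ff'. Qed.

Lemma linear_tlift (U V W X : vectType k) (h : W -> X) (f : U -> V -> W) t :
  linear h -> h (tlift f t) = tlift (fun u v => h (f u v)) t.
Proof.
move=> lh; pose m := GRing.isLinear.Build k W X *:%R h lh.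
pose F : {linear W -> X} := HB.pack h m; rewrite -[h _]/(F _).
rewrite /tlift linear_sum; apply: eq_bigr => i _.
by rewrite linear_sum; apply: eq_bigr => j _; rewrite linearZ.
Qed.

Lemma tlift_tlift (U V U' V' W : vectType k) (g : U' -> V' -> W)
    (f : U -> V -> tensor U' V') t :
  tlift g (tlift f t) = tlift (fun u v => tlift g (f u v)) t.
Proof. by rewrite (linear_tlift (h := tlift g)) //; apply: tlift_linear. Qed.

Lemma tlift_exchange (U V U' V' W : vectType k)
    (f : U -> V -> U' -> V' -> W) s t :
  tlift (fun u v => tlift (f u v) t) s
    = tlift (fun u' v' => tlift (fun u v => f u v u' v') s) t.
Proof.
rewrite /tlift.
under eq_bigr do under eq_bigr do
  (rewrite scaler_sumr; under eq_bigr do rewrite scaler_sumr).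
under [RHS]eq_bigr do under eq_bigr do
  (rewrite scaler_sumr; under eq_bigr do rewrite scaler_sumr).
under eq_bigr do rewrite exchange_big.
rewrite exchange_big; apply: eq_bigr => i' _.
under eq_bigr do rewrite exchange_big.
rewrite exchange_big; apply: eq_bigr => j' _; do 2!apply: eq_bigr => ? _.
by rewrite !scalerA mulrC.
Qed.

Lemma tlift_tpure (U V : vectType k) (t : tensor U V) :
  tlift (@tpure k U V) t = t.
Proof. by rewrite -(tlift_unique (idfun : {linear _ -> _})). Qed.

(** Contraction becomes a row vector times the matrix [t], so that matrix inversion applies to
    tensors. *)
Lemma coord_tlift_form (U V : vectType k) (phi : U -> k) (t : tensor U V) j :
  coord (vbasis {:V}) j (tlift (fun u v => phi u *: v) t)
    = (\row_i phi (vbasis {:U})`_i *m (t : 'M_(_, _))) ord0 j.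
Proof.
rewrite /tlift !mxE linear_sum; apply: eq_bigr => i _; rewrite linear_sum.
rewrite (bigD1 j) //= big1 ?addr0 => [|j' j'j].
  by rewrite !linearZ /= coord_free ?(basis_free (vbasisP _)) // eqxx mulr1
    mxE mulrC.
by rewrite !linearZ /= coord_free ?(basis_free (vbasisP _)) // (negPf j'j)
  !mulr0.
Qed.

(* A tensor whose left contractions fill [U] is an invertible matrix. *)
Lemma tlift_form_inj (U : vectType k) (t : tensor U U) (phi : U -> U -> k)
    (mu nu : {scalar U}) :
    (forall u, tlift (fun a b => phi u a *: b) t = u) ->
    tlift (fun a b => mu a *: b) t = tlift (fun a b => nu a *: b) t ->
  mu =1 nu.
Proof.
move=> phiE munuE.
pose B : 'M_(\dim {:U}) :=
  \matrix_(i, j) phi (vbasis {:U})`_i (vbasis {:U})`_j.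
have BtE : B *m (t : 'M_(_, _)) = 1%:M.
  apply/matrixP => i j; have := coord_tlift_form (phi (vbasis {:U})`_i) t j.
  rewrite phiE coord_free ?(basis_free (vbasisP _)) // => e.
  rewrite [RHS]mxE; apply: etrans (esym e); rewrite !mxE.
  apply: eq_bigr => l _; congr (_ * _).
  by rewrite !mxE.
pose row (xi : {scalar U}) : 'rV_(\dim {:U}) := \row_i xi (vbasis {:U})`_i.
(* Since [B] is square, it is also a right inverse of [t], and a row is recovered from its product
   with [t]. *)
have rowE : row mu = row nu.
  rewrite -[row mu]mulmx1 -[row nu]mulmx1 -(mulmx1C BtE) !mulmxA.
  congr (_ *m _); apply/rowP => j.
  by rewrite -!coord_tlift_form munuE.
move=> x; rewrite (coord_vbasis (memvf x)) !linear_sum; apply: eq_bigr => i _.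
by rewrite !linearZ; have /rowP/(_ i) := rowE; rewrite !mxE => ->.
Qed.

Variable A : falgType k.

Lemma mul2_sweedler (W : vectType k) (f : A -> A -> W) (s t : A \ox A) :
    (forall b, linear (fun a => f a b)) -> (forall a, linear (f a)) ->
  tlift f (mul2 s t)
    = tlift (fun a b => tlift (fun a' b' => f (a * a') (b * b')) t) s.
Proof.
move=> fl fr; rewrite /mul2 /tmul tlift_tlift; apply: eq_tlift => a b.
by rewrite tlift_tlift; apply: eq_tlift => a' b'; rewrite tlift_pure.
Qed.

Lemma mul2A (r s t : A \ox A) : mul2 (mul2 r s) t = mul2 r (mul2 s t).
Proof.
rewrite [LHS]mul2_sweedler; [|by lin|by lin]; apply: eq_tlift => a b.
rewrite mul2_sweedler; [|by lin|by lin]; do 2!apply: eq_tlift => ? ?.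
by rewrite !mulrA.
Qed.

Lemma mul2_1 (t : A \ox A) : mul2 t (1 \ot 1) = t.
Proof.
rewrite -[RHS]tlift_tpure; apply: eq_tlift => a b.
by rewrite tlift_pure ?mulr1 //; lin.
Qed.

End Sweedler.

(** * Antipode and integrals *)

Section HopfAlgebra.
Variables (k : fieldType) (A : falgType k) (H : hopf A).

Local Notation Delta := (comul H).
Local Notation eps := (counit H).
Local Notation S := (antipode H).

Lemma comul_coassoc (W : vectType k) (f : A -> A -> A -> W) x :
    (forall b c, linear (fun a => f a b c)) ->
    (forall a c, linear (fun b => f a b c)) ->
    (forall a b, linear (fun c => f a b c)) ->
  tlift (fun a c => tlift (fun a1 a2 => f a1 a2 c) (Delta a)) (Delta x)
    = tlift (fun a b => tlift (fun b1 b2 => f a b1 b2) (Delta b)) (Delta x).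
Proof.
move=> fl fm fr.
have := congr1 (tlift (fun t c => tlift (fun a b => f a b c) t)) (comulA H x).
rewrite /tmap /tassoc !tlift_tlift.
under eq_tlift => a c do (rewrite tlift_pure; [|by lin|by lin]).
move=> ->; apply: eq_tlift => a b.
rewrite tlift_pure; [|by lin|by lin].
rewrite tlift_tlift; apply: eq_tlift => b1 b2.
by rewrite !tlift_pure //; lin.
Qed.

Lemma comulM_sweedler (W : vectType k) (f : A -> A -> W) x y :
    (forall b, linear (fun a => f a b)) -> (forall a, linear (f a)) ->
  tlift f (Delta (x * y))
    = tlift (fun a b => tlift (fun a' b' => f (a * a') (b * b')) (Delta y))
        (Delta x).
Proof. by move=> fl fr; rewrite comulM mul2_sweedler. Qed.

Lemma tlift_counitl (W : vectType k) (f : A -> W) x :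
  linear f -> tlift (fun a b => eps a *: f b) (Delta x) = f x.
Proof.
move=> lf; rewrite -[in RHS](counitl H x) (linear_tlift _ _ lf).
by apply: eq_tlift => a b; rewrite (GRing.scalable_linear lf).
Qed.

Lemma tlift_counitr (W : vectType k) (f : A -> W) x :
  linear f -> tlift (fun a b => eps b *: f a) (Delta x) = f x.
Proof.
move=> lf; rewrite -[in RHS](counitr H x) (linear_tlift _ _ lf).
by apply: eq_tlift => a b; rewrite (GRing.scalable_linear lf).
Qed.

Lemma tlift_antipodel (W : vectType k) (f : A -> W) x :
  linear f -> tlift (fun a b => f (S a * b)) (Delta x) = eps x *: f 1.
Proof.
move=> lf; rewrite -(GRing.scalable_linear lf) -(antipodel H x).
by rewrite (linear_tlift _ _ lf).
Qed.

Lemma tlift_antipoder (W : vectType k) (f : A -> W) x :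
  linear f -> tlift (fun a b => f (a * S b)) (Delta x) = eps x *: f 1.
Proof.
move=> lf; rewrite -(GRing.scalable_linear lf) -(antipoder H x).
by rewrite (linear_tlift _ _ lf).
Qed.

Lemma antipode1 : S 1 = 1.
Proof.
have := antipodel H 1; rewrite comul1 tlift_pure; [|by lin|by lin].
by rewrite counit1 scale1r mulr1.
Qed.

(* Both sides are convolution inverses of the product [A \ox A -> A]: the
   proof evaluates the sum of [S y1 S x1 x2 y2 S (x3 y3)] in two ways. *)
Lemma antipodeM x y : S (x * y) = S y * S x.
Proof.
transitivity (tlift (fun y1 y' => tlift (fun y2 y3 =>
    tlift (fun x1 x' => tlift (fun x2 x3 =>
      S y1 * (S x1 * x2) * y2 * S (x3 * y3)) (Delta x')) (Delta x))
    (Delta y')) (Delta y)).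
  (* First evaluation: [S x1 * x2] collapses, then [S y1 * y2], leaving [S (x * y)]. *)
  under [RHS]eq_tlift do under eq_tlift do
    (rewrite -comul_coassoc; [|by lin|by lin|by lin];
     under eq_tlift do (rewrite (tlift_antipodel (f := fun z => _ * z * _ * _));
       [rewrite mulr1|by lin]);
     rewrite (tlift_counitl (f := fun z => _ * S (z * _))); [|by lin]).
  rewrite -comul_coassoc; [|by lin|by lin|by lin].
  under [RHS]eq_tlift do
    (rewrite (tlift_antipodel (f := fun z => z * _)); [rewrite mul1r|by lin]).
  by rewrite (tlift_counitl (f := fun z => S (_ * z))) //; lin.
(* Second evaluation: [x2 * y2] and [x3 * y3] are the two legs of the coproduct of a product, so the
   antipode axiom collapses them and leaves [z = S y1 * S x1]. *)
have antipode_comulM a b z : tlift (fun a1 a2 => tlift (fun b1 b2 =>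
      z * a1 * b1 * S (a2 * b2)) (Delta b)) (Delta a) = eps a *: (eps b *: z).
  transitivity (tlift (fun c c' => z * (c * S c')) (Delta (a * b))).
    rewrite comulM_sweedler; [|by lin|by lin].
    by do 2!apply: eq_tlift => ? ?; rewrite !mulrA.
  rewrite (tlift_antipoder (f := fun c => z * c)); last by lin.
  by rewrite mulr1 counitM scalerA.
under eq_tlift do (rewrite tlift_exchange; under eq_tlift do
  (rewrite tlift_exchange; under eq_tlift do under eq_tlift do rewrite mulrA;
   rewrite antipode_comulM);
  rewrite (tlift_counitr (f := fun z => _ *: (_ * S z))); [|by lin]).
by rewrite (tlift_counitr (f := fun z => S z * _)) //; lin.
Qed.

(** * Integrals, cointegrals and the trace-like property *)

Section Integral.
Variable (Lambda : A).

(** Evaluate the sum of $S(x_1)x_2\Lambda_1\otimes x_3\Lambda_2$ in two ways. Grouping $x_2,x_3$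
    gives $\Delta(x'\Lambda)=\epsilon(x')\Delta(\Lambda)$; grouping $x_1,x_2$ cancels the
    antipode. *)
Lemma integral_antipodel (W : vectType k) (f : A -> A -> W) x :
    left_integral H Lambda ->
    (forall b, linear (fun a => f a b)) -> (forall a, linear (f a)) ->
  tlift (fun a b => f (S x * a) b) (Delta Lambda)
    = tlift (fun a b => f a (x * b)) (Delta Lambda).
Proof.
move=> intL fl fr.
transitivity (tlift (fun x1 x' => tlift (fun x2 x3 => tlift (fun a b =>
   f (S x1 * (x2 * a)) (x3 * b)) (Delta Lambda)) (Delta x')) (Delta x)).
  under [RHS]eq_tlift => x1 x' do
    (rewrite -(comulM_sweedler (f := fun a b => f (S x1 * a) b));
       [|by lin|by lin];
     rewrite intL linearZ /= (GRing.scalable_linear (@tlift_linear k A A W _))).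
  rewrite (tlift_counitr (f := fun z => tlift (fun a b => f (S z * a) b) _)) //.
  by lin.
rewrite -comul_coassoc; [|by lin|by lin|by lin].
under [LHS]eq_tlift do (under eq_tlift do under eq_tlift do rewrite mulrA;
  rewrite (tlift_antipodel
    (f := fun z => tlift (fun a b => f (z * a) (_ * b)) _));
  [|by lin]).
rewrite (tlift_counitl
  (f := fun z => tlift (fun a b => f (1 * a) (z * b)) _)); last by lin.
by under eq_tlift do rewrite mul1r.
Qed.

(** Mirror argument, with the sum of $\Lambda_1x_1\otimes\Lambda_2x_2S(x_3)$ and $\Lambda
    x'=\epsilon(x')\Lambda$. *)
Lemma integral_antipoder (W : vectType k) (f : A -> A -> W) x :
    right_integral H Lambda ->
    (forall b, linear (fun a => f a b)) -> (forall a, linear (f a)) ->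
  tlift (fun a b => f (a * x) b) (Delta Lambda)
    = tlift (fun a b => f a (b * S x)) (Delta Lambda).
Proof.
move=> intL fl fr.
transitivity (tlift (fun a b => tlift (fun x1 x' => tlift (fun x2 x3 =>
   f (a * x1) (b * x2 * S x3)) (Delta x')) (Delta x)) (Delta Lambda)).
  apply: eq_tlift => a b.
  under [RHS]eq_tlift do
    (under eq_tlift do rewrite -mulrA;
     rewrite (tlift_antipoder (f := fun z => f _ (b * z))); [|by lin]).
  by rewrite (tlift_counitr (f := fun z => f (a * z) (b * 1))) ?mulr1 //; lin.
under eq_tlift do (rewrite -comul_coassoc; [|by lin|by lin|by lin]).
rewrite tlift_exchange.
under eq_tlift => x' x3 do
  (rewrite -(comulM_sweedler (f := fun a b => f a (b * S x3)));
     [|by lin|by lin];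
   rewrite intL linearZ /= (GRing.scalable_linear (@tlift_linear k A A W _))).
rewrite (tlift_counitl (f := fun z => tlift (fun a b => f a (b * S z)) _)) //.
by lin.
Qed.

Variable (lam : {scalar A}).
Hypotheses (intL : integral H Lambda) (cointL : right_cointegral H lam).
Hypothesis (lamL : lam Lambda = 1).

(** Moving [S a] across [Delta Lambda] leaves [a] times the contraction of [Delta Lambda] by [lam],
    which is 1. Besides the right unit law, this shows that every vector is a left contraction of
    [Delta Lambda]. *)
Lemma star_integral a : star H lam a Lambda = a.
Proof.
rewrite /star (integral_antipodel (f := fun a b => lam a *: b) _ intL.1);
  [|by lin|by lin].
under eq_tlift do rewrite scalerAr.
rewrite -(linear_tlift (h := fun z => a * z)); last by lin.
by rewrite cointL lamL scale1r mulr1.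
Qed.

(* Both functionals of [y] contract [Delta Lambda] to [S x]. *)
Lemma cointegral_antipode2 x y : lam (y * x) = lam (S (S x) * y).
Proof.
have lin1 : scalar (fun y => lam (y * x)).
  by move=> c u v; rewrite mulrDl -scalerAl linearP.
have lin2 : scalar (fun y => lam (S (S x) * y)).
  by move=> c u v; rewrite mulrDr -scalerAr linearP.
pose mu : {scalar A} :=
  HB.pack (fun y => lam (y * x)) (GRing.isLinear.Build k A k *%R _ lin1).
pose nu : {scalar A} :=
  HB.pack (fun y => lam (S (S x) * y)) (GRing.isLinear.Build k A k *%R _ lin2).
(* By [star_integral], the form [lam (S u * _)] contracts [Delta Lambda] to [u], so [Delta Lambda]
   separates functionals. The same lemma at [S x] computes the contraction by [nu]. *)
apply: (tlift_form_inj (phi := fun u a => lam (S u * a)) (mu := mu) (nu := nu)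
  (t := Delta Lambda)) => [u|]; first exact: star_integral.
rewrite /mu /nu /=.
rewrite (integral_antipoder (f := fun a b => lam a *: b) _ intL.2);
  [|by lin|by lin].
under eq_tlift do rewrite scalerAl.
rewrite -(linear_tlift (h := fun z => z * S x)); last by lin.
by rewrite cointL lamL scale1r mul1r; apply/esym/star_integral.
Qed.

End Integral.

(** * The monodromy map *)

Section Quasitriangular.
Variable R : A \ox A.
Hypothesis qtR : quasitriangular H R.

(** This is $R\Delta(x)=\Delta^{op}(x)R$, the conjugation axiom multiplied by $R$ on the right so
    that no inverse remains. *)
Lemma Rmatrix_comul (W : vectType k) (f : A -> A -> W) x :
    (forall b, linear (fun a => f a b)) -> (forall a, linear (f a)) ->
  tlift (fun a b => tlift (fun x1 x2 => f (a * x1) (b * x2)) (Delta x)) R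
    = tlift (fun x1 x2 => tlift (fun a b => f (x2 * a) (x1 * b)) R) (Delta x).
Proof.
move=> fl fr; have [Ri [_ RiR /(_ x) swapE]] := Rmatrix_conj qtR.
have {Ri RiR}swapE : mul2 (tswap (Delta x)) R = mul2 R (Delta x).
  by rewrite swapE mul2A RiR mul2_1.
rewrite -mul2_sweedler // -swapE mul2_sweedler // /tswap tlift_tlift.
by apply: eq_tlift => x1 x2; rewrite tlift_pure //; lin.
Qed.

Lemma Rmatrix_comull_sweedler (W : vectType k) (f : A -> A -> A -> W) :
    (forall b c, linear (fun a => f a b c)) ->
    (forall a c, linear (fun b => f a b c)) ->
    (forall a b, linear (fun c => f a b c)) ->
  tlift (fun a b => tlift (fun a1 a2 => f a1 a2 b) (Delta a)) R
    = tlift (fun a b => tlift (fun a' b' => f a a' (b * b')) R) R.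
Proof.
move=> fl fm fr.
have := congr1 (tlift (fun t c => tlift (fun a b => f a b c) t))
  (Rmatrix_comull qtR).
rewrite /tmap /mul3 /mul2 /tmul /leg13 /leg23 !tlift_tlift.
under eq_tlift => a b do (rewrite tlift_pure; [|by lin|by lin]).
move=> ->; apply: eq_tlift => a b.
rewrite tlift_pure; [|by lin|by lin]; rewrite !tlift_tlift.
apply: eq_tlift => a' b'; do 5!(rewrite tlift_pure; [|by lin|by lin]).
by rewrite mulr1 mul1r.
Qed.

Lemma Rmatrix_comulr_sweedler (W : vectType k) (f : A -> A -> A -> W) :
    (forall b c, linear (fun a => f a b c)) ->
    (forall a c, linear (fun b => f a b c)) ->
    (forall a b, linear (fun c => f a b c)) ->
  tlift (fun a b => tlift (fun b1 b2 => f a b1 b2) (Delta b)) R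
    = tlift (fun a b => tlift (fun a' b' => f (a * a') b' b) R) R.
Proof.
move=> fl fm fr.
have := congr1 (tlift (fun t c => tlift (fun a b => f a b c) t))
  (Rmatrix_comulr qtR).
rewrite /tassoc /tmap /mul3 /mul2 /tmul /leg13 /leg12 !tlift_tlift.
under eq_tlift => a b do (rewrite tlift_pure; [|by lin|by lin];
  rewrite tlift_tlift;
  under eq_tlift do do 2!(rewrite tlift_pure; [|by lin|by lin])).
move=> ->; apply: eq_tlift => a b.
rewrite tlift_pure; [|by lin|by lin]; rewrite !tlift_tlift.
do 3!(rewrite tlift_pure; [|by lin|by lin]); rewrite !tlift_tlift.
apply: eq_tlift => a' b'; rewrite tlift_pure; [|by lin|by lin].
by rewrite mulr1 mul1r.
Qed.

(** The element $R_{21}R$: the outer copy of [R] is the flipped one. *)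
Definition monodromy : A \ox A :=
  tlift (fun a b => tlift (fun a' b' => (b * a') \ot (a * b')) R) R.

(** $R$ turns $\Delta$ into $\Delta^{op}$ and $R_{21}$ turns it back, so $R_{21}R$ commutes with
    every $\Delta(x)$. *)
Lemma monodromy_comul (W : vectType k) (f : A -> A -> W) x :
    (forall b, linear (fun a => f a b)) -> (forall a, linear (f a)) ->
  tlift (fun a b => tlift (fun x1 x2 => f (a * x1) (b * x2)) (Delta x))
      monodromy
    = tlift (fun a b => tlift (fun x1 x2 => f (x1 * a) (x2 * b)) (Delta x))
        monodromy.
Proof.
move=> fl fr; rewrite /monodromy !tlift_tlift.
under eq_tlift => a b do
  (rewrite tlift_tlift;
   under eq_tlift do
     (rewrite tlift_pure; [|by lin|by lin];
      under eq_tlift do rewrite -!mulrA);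
   rewrite (Rmatrix_comul (f := fun u v => f (b * u) (a * v)));
     [|by lin|by lin];
   rewrite tlift_exchange).
under [RHS]eq_tlift => a b do
  (rewrite tlift_tlift;
   under eq_tlift do (rewrite tlift_pure; [|by lin|by lin])).
under [RHS]eq_tlift => a b do rewrite tlift_exchange.
rewrite tlift_exchange.
(* Exchanging the two arguments of [f] turns [Rmatrix_comul] into
   $R_{21}\Delta^{op}(x)=\Delta(x)R_{21}$. *)
under eq_tlift => a' b' do
  (under eq_tlift do under eq_tlift do rewrite !mulrA;
   rewrite (Rmatrix_comul (f := fun u v => f (v * a') (u * b')));
     [|by lin|by lin]).
rewrite tlift_exchange [RHS]tlift_exchange; apply: eq_tlift => x1 x2.
by rewrite tlift_exchange; do 2!apply: eq_tlift => ? ?; rewrite !mulrA.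
Qed.

(** * The group-like element and the map $J$ on the center *)

Section Ribbon.
Variables (g : A) (lam : {scalar A}).
Hypothesis gU : g \is a GRing.unit.
Hypothesis gg : Delta g = g \ot g.
Hypothesis antipode2 : forall a, S (S a) = g * a * g^-1.
Hypothesis lam_trace : forall x y, lam (y * x) = lam (S (S x) * y).

Lemma antipode_inj : injective S.
Proof.
move=> a b /(congr1 S); rewrite !antipode2 => /(mulIr _)-/(_ _)/(mulrI gU).
by apply; rewrite unitrV.
Qed.

Lemma antipode_surj a : exists b, S b = a.
Proof.
exists (S (g^-1 * a * g)); rewrite antipode2.
by rewrite !mulrA mulrV // mul1r mulrK.
Qed.

(** Identifies [g^-1 * S a * g] as $S^{-1}(a)$, the form in which the inverse antipode is written
    below. *)
Lemma antipode_conj a : S (g^-1 * S a * g) = a.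
Proof.
have [b <-] := antipode_surj a.
by rewrite antipode2 !mulrA mulVr // mul1r mulrVK.
Qed.

(** The sum of $x_2S^{-1}(x_1)$ is $\epsilon(x)1$: applying the injective, product-reversing $S$
    turns it into the sum of $x_1S(x_2)$. *)
Lemma tlift_antipode_conj (W : vectType k) (f : A -> W) x :
  linear f ->
  tlift (fun a b => f (b * (g^-1 * S a * g))) (Delta x) = eps x *: f 1.
Proof.
move=> lf; rewrite -(GRing.scalable_linear lf).
rewrite -(linear_tlift (h := f)) //; congr f; apply: antipode_inj.
rewrite linear_tlift; last by lin.
under eq_tlift do rewrite antipodeM antipode_conj.
by rewrite antipoder linearZ /= antipode1.
Qed.

Lemma Jmap_monodromy z :
  Jmap R lam z = tlift (fun a b => lam (z * a) *: b) monodromy.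
Proof.
rewrite /Jmap /monodromy !tlift_tlift; apply: eq_tlift => a b.
rewrite tlift_tlift; apply: eq_tlift => a' b'.
by rewrite tlift_pure ?mulrA //; lin.
Qed.

(* [S x1 x2] is inserted next to [monodromy], [x2 \ot x3] commutes past it,
   and the trace property of [lam] brings [S x1] to the other side as [S^-1 x1],
   where it cancels [x2]. *)
Lemma Jmap_comm z x : (forall a, z * a = a * z) ->
  x * Jmap R lam z = Jmap R lam z * x.
Proof.
move=> zC; rewrite Jmap_monodromy.
rewrite (linear_tlift (h := fun u => u * x)); last by lin.
rewrite (linear_tlift (h := fun u => x * u)); last by lin.
transitivity (tlift (fun x1 x' => tlift (fun x2 x3 => tlift (fun a b =>
    lam (z * (S x1 * (x2 * a))) *: (x3 * b)) monodromy) (Delta x')) (Delta x)).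
  rewrite -comul_coassoc; [|by lin|by lin|by lin].
  under [RHS]eq_tlift do
    (under eq_tlift do under eq_tlift do rewrite [S _ * _]mulrA;
    rewrite (tlift_antipodel
      (f := fun u => tlift (fun a b => lam (z * (u * a)) *: (_ * b)) _));
    [|by lin]).
  rewrite (tlift_counitl
    (f := fun u => tlift (fun a b => lam (z * (1 * a)) *: (u * b)) _)).
    under [RHS]eq_tlift do rewrite mul1r.
    by apply: eq_tlift => a b; rewrite scalerAr.
  by lin.
transitivity (tlift (fun x1 x' => tlift (fun x2 x3 => tlift (fun a b =>
    lam (z * (a * x2 * (g^-1 * S x1 * g))) *: (b * x3)) monodromy) (Delta x'))
    (Delta x)).
  apply: eq_tlift => x1 x'.
  rewrite tlift_exchange [RHS]tlift_exchange.
  rewrite (monodromy_comul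
    (f := fun u v => lam (z * (u * (g^-1 * S x1 * g))) *: v)); [|by lin|by lin].
  do 2!apply: eq_tlift => ? ?; congr (_ *: _).
  (* The trace property turns $S^{-1}(x_1)$ on the right into $S(x_1)$ on the left, and the latter
     commutes with the central [z]. *)
  by rewrite [RHS](congr1 lam (mulrA _ _ _)) lam_trace antipode_conj !mulrA zC.
rewrite -comul_coassoc; [|by lin|by lin|by lin].
under eq_tlift do
  (rewrite tlift_exchange;
   under eq_tlift do
     (under eq_tlift do rewrite -[_ * _ * (_ * g)]mulrA;
      rewrite (tlift_antipode_conj (f := fun u => lam (z * (_ * u)) *: _));
        [rewrite mulr1|by lin])).
rewrite tlift_exchange; apply: eq_tlift => a b.
rewrite (tlift_counitl (f := fun u => lam (z * a) *: (b * u))) ?scalerAl //.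
by lin.
Qed.

Lemma antipode_central z : (forall a, z * a = a * z) ->
  forall a, S z * a = a * S z.
Proof.
by move=> zC a; have [b <-] := antipode_surj a; rewrite -!antipodeM zC.
Qed.

(** Since $\Delta(g)=g\otimes g$ is fixed by the flip, $R$ commutes with $g\otimes g$. *)
Lemma Rmatrix_conj_grouplike (W : vectType k) (f : A -> A -> W) :
    (forall b, linear (fun a => f a b)) -> (forall a, linear (f a)) ->
  tlift (fun a b => f (g^-1 * a * g) (g^-1 * b * g)) R = tlift f R.
Proof.
move=> fl fr.
transitivity (tlift (fun a b => tlift (fun x1 x2 =>
    f (g^-1 * (a * x1)) (g^-1 * (b * x2))) (Delta g)) R).
  rewrite gg; apply: eq_tlift => a b.
  by rewrite tlift_pure ?mulrA //; lin.
rewrite (Rmatrix_comul (f := fun u v => f (g^-1 * u) (g^-1 * v)));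
  [|by lin|by lin].
rewrite gg tlift_pure; [|by lin|by lin].
by apply: eq_tlift => a b; rewrite !mulKr.
Qed.

(** Conjugation by $g^{-1}$ is $S^{-2}$, which undoes the $S^2$ of the trace property. *)
Lemma lam_conj_grouplike x y : lam (y * (g^-1 * x * g)) = lam (x * y).
Proof. by rewrite lam_trace antipode2 !mulrA mulrV // mul1r mulrK. Qed.

Lemma star_Jmap a b :
    (forall x, a * x = x * a) -> (forall x, b * x = x * b) ->
  star H lam a (Jmap R lam b) = Jmap R lam (b * Jmap R lam (S a)).
Proof.
move=> aC bC; have SaC := antipode_central aC.
have JSaC x := Jmap_comm x SaC.
pose F y := tlift (fun y1 y2 => lam (S a * y1) *: y2) (Delta y).
have linF : linear F by rewrite /F; lin.
(* Each of the two copies of [R] in $J(b)$ splits in two under $\Delta$. Copies 2 and 3 form the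
   outer $J$ of the right-hand side, copies 4 and 1 will form $J(S(a))$. *)
transitivity (tlift (fun a1 b1 => tlift (fun a2 b2 => tlift (fun a3 b3 =>
    tlift (fun a4 b4 =>
      lam (b * (b1 * b2) * (a3 * a4)) *: (lam (S a * (a1 * b4)) *: (a2 * b3)))
    R) R) R) R).
  rewrite -[LHS]/(F _) /Jmap (linear_tlift _ _ linF).
  rewrite -(Rmatrix_comull_sweedler (f := fun a1 a2 b1 =>
    tlift (fun a3 b3 => tlift (fun a4 b4 =>
      lam (b * b1 * (a3 * a4)) *: (lam (S a * (a1 * b4)) *: (a2 * b3)))
    R) R)); [|by lin|by lin|by lin].
  apply: eq_tlift => a1 b1; rewrite (linear_tlift _ _ linF).
  under [RHS]eq_tlift => a2 a3 do
    (rewrite -(Rmatrix_comulr_sweedler (f := fun a4 b4 b5 =>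
       lam (b * b1 * a4) *: (lam (S a * (a2 * b4)) *: (a3 * b5))));
     [|by lin|by lin|by lin]).
  rewrite tlift_exchange; apply: eq_tlift => a2 b2.
  rewrite (GRing.scalable_linear linF) /= /F comulM_sweedler; [|by lin|by lin].
  rewrite (linear_tlift (h := fun u => _ *: u)); last by lin.
  apply: eq_tlift => ? ?.
  by rewrite (linear_tlift (h := fun u => _ *: u)) //; lin.
rewrite tlift_exchange; apply: eq_tlift => a2 b2.
rewrite tlift_exchange; apply: eq_tlift => a3 b3.
rewrite tlift_exchange.
(* Centrality of $J(S(a))$ moves it to the end of the argument of [lam], where [a4 * b1] stands
   after expansion. *)
have -> : b * Jmap R lam (S a) * b2 * a3 = b * b2 * a3 * Jmap R lam (S a).
  by rewrite -[b * b2 * a3]mulrA -[RHS]mulrA (JSaC (b2 * a3)) !mulrA.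
rewrite /Jmap.
pose h u := lam (b * b2 * a3 * u) *: (a2 * b3).
have linh : linear h by rewrite /h; lin.
rewrite -[RHS]/(h _) (linear_tlift _ _ linh); apply: eq_tlift => a4 b4.
rewrite (linear_tlift _ _ linh).
(* Conjugating copy 1 by $g$ lets [lam_conj_grouplike] carry [a1] and [b1] to the front of their
   respective [lam] factors; centrality of [S a] and [b] then matches the two sides. *)
rewrite -[RHS]Rmatrix_conj_grouplike; [|by rewrite /h; lin|by rewrite /h; lin].
apply: eq_tlift => a1 b1; rewrite (GRing.scalable_linear linh) /= /h.
rewrite lam_conj_grouplike [S a * _ as X in lam X]mulrA.
rewrite [b * b2 * a3 * _ as X in lam X]mulrA lam_conj_grouplike.
by rewrite !scalerA [in RHS]mulrC !mulrA bC SaC.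
Qed.

End Ribbon.
End Quasitriangular.
End HopfAlgebra.

(** * The center and the transport of its algebra structure *)

Lemma centervP (k : fieldType) (A : falgType k) (z : A) :
  reflect (forall a, z * a = a * z) (z \in 'Z({:A})%VS).
Proof.
rewrite memv_cap memvf /=.
by apply: (iffP centvP) => zC a => [|_]; apply: zC; rewrite ?memvf.
Qed.

(** The map [h] is injective on [V], hence onto [V] by dimension; writing [y = h x] turns the left
    inverse into a right inverse. *)
Lemma linear_cancel_in (k : fieldType) (U : vectType k) (V : {vspace U})
    (f h : U -> U) :
    linear h -> {in V, forall x, h x \in V} -> {in V, cancel h f} ->
  {in V, cancel f h}.
Proof.
move=> linh hV hK.
pose m := GRing.isLinear.Build k U U *:%R h linh.
pose hL : {linear U -> U} := HB.pack h m.
have hE : linfun hL =1 h by move=> x; rewrite lfunE.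
have h0 : h 0 = 0 by apply: (linear0 hL).
have : \dim (linfun hL @: V) = \dim V.
  apply: limg_dim_eq; apply/eqP; rewrite -subv0; apply/subvP => x.
  rewrite memv_cap memv_ker hE => /andP[xV /eqP hx0]; rewrite memv0.
  by rewrite -(hK x xV) hx0 -{1}h0 hK ?mem0v.
move/eqP => dimE; have hVV : (linfun hL @: V <= V)%VS.
  by apply/subvP => _ /memv_imgP[x xV ->]; rewrite hE hV.
have {dimE hVV} hVE : (linfun hL @: V)%VS = V.
  by apply/eqP; rewrite eqEdim hVV (eqP dimE) /=.
move=> y; rewrite -{1}hVE => /memv_imgP[x xV ->]; rewrite hE.
by rewrite hK.
Qed.

Theorem corollary2p9 (k : fieldType) (A : falgType k) (H : hopf A)
    (R : A \ox A) (g : A) (Lambda : A) (lam : {scalar A}) (gamma : k) :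
  ribbon H R g ->
  unimodular H ->
  integral H Lambda ->
  right_cointegral H lam ->
  lam Lambda = 1 ->
  gamma \is a GRing.unit ->
  Jmap R lam 1 = gamma *: Lambda ->
  algebra_iso 'Z({:A})%VS *%R 1 'Z({:A})%VS (star H lam) Lambda
      (fun z => gamma^-1 *: Jmap R lam z)
  /\ {in 'Z({:A})%VS &, commutative (star H lam)}.
Proof.
move=> [qtR gU gg antipode2 _] _ intL cointL lamL gammaU J1.
set Z := 'Z({:A})%VS; set J := Jmap R lam; set F := fun z => gamma^-1 *: J z.
have lam_trace := cointegral_antipode2 intL cointL lamL.
have linJ : linear J by rewrite /J /Jmap; lin.
have linF : linear F by apply: linear_scale.
have starl y : linear (fun x => star H lam x y) by rewrite /star; lin.
have starr x : linear (star H lam x) by rewrite /star; lin.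
have JZ x : x \in Z -> J x \in Z.
  move=> /centervP xC; apply/centervP => a.
  exact/esym/(Jmap_comm qtR gU antipode2 lam_trace).
have SZ x : x \in Z -> antipode H x \in Z.
  move=> /centervP xC; apply/centervP.
  exact: (antipode_central gU antipode2).
have starJ x y : x \in Z -> y \in Z ->
    star H lam x (J y) = J (y * J (antipode H x)).
  move=> /centervP xC /centervP yC.
  exact: (star_Jmap qtR gU gg antipode2 lam_trace).
have ZM : {in Z &, forall x y, x * y \in Z}.
  move=> x y /centervP xC /centervP yC; apply/centervP => a.
  by rewrite -mulrA yC mulrA xC mulrA.
have Z1 : 1 \in Z by apply/centervP => a; rewrite mul1r mulr1.
have F1 : F 1 = Lambda by rewrite /F /J J1 scalerA mulVr // scale1r.
(* The inverse of [J] on the center, read off from $J(J(S(x)))=\gamma x$. *)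
pose h x := gamma^-1 *: J (antipode H x).
have linh : linear h by apply/linear_scale/(linear_comp_fun linJ)/linearP.
have hZ x : x \in Z -> h x \in Z by move=> xZ; rewrite memvZ ?JZ ?SZ.
have hK : {in Z, cancel h J}.
  move=> x xZ; rewrite /h (GRing.scalable_linear linJ) /=.
  (* At [y = 1] the identity [starJ] computes $J(J(S(x)))$ as $x\star
     J(1)=\gamma(x\star\Lambda)$. *)
  have := starJ x 1 xZ Z1; rewrite mul1r => <-.
  rewrite -(GRing.scalable_linear (starr x)) -/(F 1) F1.
  exact: star_integral.
have JK : {in Z, cancel J h} by apply: linear_cancel_in.
have FM : {in Z &, {morph F : x y / x * y >-> star H lam x y}}.
  move=> x y xZ yZ; rewrite [F y]/F (GRing.scalable_linear (starr _)) /=.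
  rewrite starJ ?memvZ ?JZ //.
  rewrite {1 2}/F !linearZ /=.
  (* Here $J(S(F(x)))=\gamma^{-1}J(S(J(x)))$ is [h (J x)], that is [x]; this uses the cancellation
     obtained by dimension. *)
  rewrite (GRing.scalable_linear linJ) /= -/(h (J x)) JK //.
  by move/centervP: xZ => ->.
have FZ x : x \in Z -> F x \in Z by move=> xZ; rewrite memvZ ?JZ.
have F_onto y : y \in Z -> exists2 x, x \in Z & F x = y.
  move=> yZ; exists (gamma *: h y); first by rewrite memvZ ?hZ.
  by rewrite (GRing.scalable_linear linF) /F /= hK // scalerA mulrV ?scale1r.
split; last first.
  move=> _ _ /F_onto[x xZ <-] /F_onto[y yZ <-].
  by rewrite -!FM //; congr F; move/centervP: xZ.
split=> //.
- split=> // [a x x' y _ _ _|a x y y' _ _ _|x y z _ _ _|x _|x _].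
  + by rewrite mulrDl scalerAl.
  + by rewrite mulrDr scalerAr.
  + exact: mulrA.
  + exact: mul1r.
  + exact: mulr1.
(* Bilinearity of [star] holds on all of [A]; the other laws are transported by writing central
   elements as values of [F]. *)
- split=> [_ _ /F_onto[x xZ <-] /F_onto[y yZ <-]||a x x' y _ _ _
    |a x y y' _ _ _|_ _ _ /F_onto[x xZ <-] /F_onto[y yZ <-] /F_onto[z zZ <-]
    |_ /F_onto[x xZ <-]|_ /F_onto[x xZ <-]].
  + by rewrite -FM ?FZ ?ZM.
  + by rewrite -F1 FZ.
  + exact: starl.
  + exact: starr.
  + by rewrite -!FM ?ZM // mulrA.
  + by rewrite -F1 -FM // mul1r.
  + by rewrite -F1 -FM // mulr1.
- by move=> a x y _ _; apply: linF.
- move=> x y xZ yZ /(congr1 ( *:%R gamma)).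
  rewrite /F !scalerA mulrV // !scale1r => Jxy.
  by rewrite -(JK x xZ) -(JK y yZ) Jxy.
Qed.
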